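(* Let $\mathcal{X}_{\rm Alg}=\{x_1,\dots,x_M\}\subseteq\mathcal{X}$ be a finite list of states, and consider the $Q$-Benders algorithm (Variant B) described in the context. Suppose that: (1) For each $x_m\in\mathcal{X}_{\rm Alg}$, the set $\mathcal{U}(x_m)$ contains an element $\hat u$ such that $Q^\star(x_m,\hat u)<\infty$. (2) For each $x_m\in\mathcal{X}_{\rm Alg}$, the set $\mathcal{U}(x_m)$ is compact, and each entry of $u\mapsto f(x_m,u)$ is Lipschitz continuous on $\mathcal{U}(x_m)$. (3) The problem data are such that the lower-bounding functions $q_0,q_1,\dots$ generated in Variant B satisfy: (i) at each iteration $I$ of the algorithm and for all $x_m\in\mathcal{X}_{\rm Alg}$, strong duality holds between the primal problem $(P_I)$ and the dual problem $(D_I)$ with parameter $(x_m,u)$, $u=\pi(x_m;Q_I)$, and an optimal dual solution is attained; (ii) for each $x_m\in\mathcal{X}_{\rm Alg}$ there is a constant $L_m$, common to all the functions $q_i$, such that every $q_i(x_m,\cdot)$ is Lipschitz continuous in $u$ on $\mathcal{U}(x_m)$ with constant $L_m$. Then, for any tolerance $\varepsilon_{\rm tol}>0$, Variant B of the algorithm terminates in finitely many iterations with probability $1$.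
   Context: Setting. $\mathcal{X}\subseteq\mathbb{R}^{n_x}$ and $\mathcal{U}\subseteq\mathbb{R}^{n_u}$ are continuous state and action spaces; $\gamma\in(0,1]$; $\ell:\mathcal{X}\times\mathcal{U}\to\mathbb{R}_+$ is the (non-negative) stage cost; $f:\mathcal{X}\times\mathcal{U}\to\mathcal{X}$ the dynamics; $h:\mathcal{X}\times\mathcal{U}\to\mathbb{R}^{n_c}$ the constraint map. Put $\mathcal{U}(x):=\{u\in\mathcal{U}: h(x,u)\le 0\}$. The optimal value function is $$V^\star(x):=\inf_{u_0,u_1,\dots}\Big\{\sum_{t=0}^\infty\gamma^t\ell(x_t,u_t)\ :\ x_0=x,\ x_{t+1}=f(x_t,u_t),\ h(x_t,u_t)\le 0\ \ \forall t\ge 0\Big\}$$ (equal to $+\infty$ if infeasible), and the optimal $Q$-function is $Q^\star(x,u)=\ell(x,u)+\gamma V^\star(f(x,u))$. Bellman operator: $\mathcal{T_Q}Q(x,u):=\ell(x,u)+\gamma\inf_{u'\in\mathcal{U}(f(x,u))}Q(f(x,u),u')$. $Q$-Bellman error: $\varepsilon(x,u;Q):=\mathcal{T_Q}Q(x,u)-Q(x,u)$. Policy: $\pi(x;Q)$ denotes a chosen element of $\arg\min_{u\in\mathcal{U}(x)}Q(x,u)$. Primal and dual problems. For $Q_I=\max_{i=0,\dots,I}q_i$ with $q_i:\mathcal{X}\times\mathcal{U}\to\mathbb{R}$, and parameter $(\hat x,\hat u)\in\mathcal{X}\times\mathcal{U}$, the primal problem is $$(P_I)\quad \mathcal{T_Q}Q_I(\hat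 x,\hat u)=\inf_{x',u',\alpha}\{\ell(\hat x,\hat u)+\gamma\alpha\ :\ x'=f(\hat x,\hat u),\ h(x',u')\le 0,\ q_i(x',u')\le\alpha,\ i=0,\dots,I\},$$ and its Lagrangian dual is $$(D_I)\quad J_D(\hat x,\hat u)=\sup_{\nu,\lambda_c,\lambda_\alpha}\{\ell(\hat x,\hat u)+\nu^\top f(\hat x,\hat u)+\xi(\nu,\lambda_c,\lambda_\alpha)\ :\ \mathbf{1}^\top\lambda_\alpha=\gamma,\ \lambda_c\ge 0,\ \lambda_\alpha\ge 0\},$$ with $\nu\in\mathbb{R}^{n_x}$, $\lambda_c\in\mathbb{R}^{n_c}$, $\lambda_\alpha\in\mathbb{R}^{I+1}$ and $$\xi(\nu,\lambda_c,\lambda_\alpha)=\inf_{(x',u')\in\mathcal{X}\times\mathcal{U}}\Big\{-\nu^\top x'+\lambda_c^\top h(x',u')+\sum_{i=0}^I\lambda_{\alpha,i}q_i(x',u')\Big\}.$$ Strong duality with parameter $(\hat x,\hat u)$ means $J_D(\hat x,\hat u)=\mathcal{T_Q}Q_I(\hat x,\hat u)$. $Q$-Benders algorithm, Variant B. Input: $\mathcal{X}_{\rm Alg}=\{x_1,\dots,x_M\}$ and $\varepsilon_{\rm tol}$. Set $I=0$, $q_0=\ell$. Repeat: let $Q_I=\max_{i=0,\dots,I}q_i$. For every $m=1,\dots,M$ compute $u_m=\pi(x_m;Q_I)$ and $\varepsilon(x_m,u_m;Q_I)$. If $\max_{m}\varepsilon(x_m,u_m;Q_I)\le\varepsilon_{\rm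 tol}$, terminate and return $Q_I$. Otherwise draw $m$ uniformly at random from $\{1,\dots,M\}$ (independently at each iteration), take $x_m$ and $u_m=\pi(x_m;Q_I)$, and, if $(P_I)$ with parameter $(x_m,u_m)$ is feasible and a dual optimal solution $(\hat\nu^\star,\hat\lambda_c^\star,\hat\lambda_\alpha^\star)$ of $(D_I)$ with that parameter is available, add the new function $$q_{I+1}(x,u):=\ell(x,u)+\hat\nu^{\star\top}f(x,u)+\xi(\hat\nu^\star,\hat\lambda_c^\star,\hat\lambda_\alpha^\star)$$ (if not, no function is added and $Q_{I+1}=Q_I$). Then increase $I$ by $1$. *)

(* Defs.v *)
From HB Require Import structures.
From mathcomp Require Import all_boot all_order all_algebra.
From mathcomp Require Import all_classical all_reals all_analysis.
Import Order.TTheory GRing.Theory Num.Theory.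
Import numFieldNormedType.Exports.

Set Implicit Arguments.
Unset Strict Implicit.
Unset Printing Implicit Defensive.

Local Open Scope classical_set_scope.
Local Open Scope ring_scope.

(* The maps are total on the ambient spaces; only their values on
   states `*` actions are constrained, and only those matter below. *)
Record problem (R : realType) (nx nu nc : nat) := Problem {
  states : set 'rV[R]_nx;
  actions : set 'rV[R]_nu;
  discount : R;
  cost : 'rV[R]_nx -> 'rV[R]_nu -> R;
  dyn : 'rV[R]_nx -> 'rV[R]_nu -> 'rV[R]_nx;
  constr : 'rV[R]_nx -> 'rV[R]_nu -> 'rV[R]_nc;
  discount_gt0 : 0 < discount;
  discount_le1 : discount <= 1;
  cost_ge0 : forall x u, states x -> actions u -> 0 <= cost x u;
  dyn_states : forall x u, states x -> actions u -> states (dyn x u)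
}.

Definition dotv (R : realType) (n : nat) (v w : 'rV[R]_n) : R :=
  \sum_(i < n) v 0 i * w 0 i.

Definition feasible (R : realType) (nx nu nc : nat) (p : problem R nx nu nc)
    (x : 'rV[R]_nx) (u : 'rV[R]_nu) : Prop :=
  forall i : 'I_nc, constr p x u 0 i <= 0.

Definition admissible (R : realType) (nx nu nc : nat) (p : problem R nx nu nc)
    (x : 'rV[R]_nx) : set 'rV[R]_nu :=
  [set u | actions p u /\ feasible p x u].

Fixpoint traj (R : realType) (nx nu nc : nat) (p : problem R nx nu nc)
    (x : 'rV[R]_nx) (u : nat -> 'rV[R]_nu) (t : nat) : 'rV[R]_nx :=
  if t is s.+1 then dyn p (traj p x u s) (u s) else x.

Definition control_seqs (R : realType) (nx nu nc : nat)
    (p : problem R nx nu nc) (x : 'rV[R]_nx) : set (nat -> 'rV[R]_nu) :=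
  [set u | forall t, admissible p (traj p x u t) (u t)].

Definition total_cost (R : realType) (nx nu nc : nat)
    (p : problem R nx nu nc) (x : 'rV[R]_nx) (u : nat -> 'rV[R]_nu) : \bar R :=
  (\sum_(0 <= t <oo) (discount p ^+ t * cost p (traj p x u t) (u t))%:E)%E.

(* ereal_inf set0 = +oo: the value is +oo at infeasible states. *)
Definition Vstar (R : realType) (nx nu nc : nat) (p : problem R nx nu nc)
    (x : 'rV[R]_nx) : \bar R :=
  ereal_inf [set total_cost p x u | u in control_seqs p x].

Definition Qstar (R : realType) (nx nu nc : nat) (p : problem R nx nu nc)
    (x : 'rV[R]_nx) (u : 'rV[R]_nu) : \bar R :=
  ((cost p x u)%:E + (discount p)%:E * Vstar p (dyn p x u))%E.

Definition bellman (R : realType) (nx nu nc : nat) (p : problem R nx nu nc)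
    (Q : 'rV[R]_nx -> 'rV[R]_nu -> \bar R)
    (x : 'rV[R]_nx) (u : 'rV[R]_nu) : \bar R :=
  let x' := dyn p x u in
  ((cost p x u)%:E +
   (discount p)%:E * ereal_inf [set Q x' u' | u' in admissible p x'])%E.

Definition bellman_error (R : realType) (nx nu nc : nat)
    (p : problem R nx nu nc) (Q : 'rV[R]_nx -> 'rV[R]_nu -> \bar R)
    (x : 'rV[R]_nx) (u : 'rV[R]_nu) : \bar R :=
  (bellman p Q x u - Q x u)%E.

Definition argmins (R : realType) (nx nu nc : nat) (p : problem R nx nu nc)
    (Q : 'rV[R]_nx -> 'rV[R]_nu -> \bar R) (x : 'rV[R]_nx) : set 'rV[R]_nu :=
  [set u | admissible p x u /\
           forall u', admissible p x u' -> (Q x u <= Q x u')%E].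

Definition is_policy (R : realType) (nx nu nc : nat) (p : problem R nx nu nc)
    (pol : 'rV[R]_nx -> ('rV[R]_nx -> 'rV[R]_nu -> \bar R) -> 'rV[R]_nu) :
    Prop :=
  forall x Q, argmins p Q x !=set0 -> argmins p Q x (pol x Q).

Definition qfun (R : realType) (nx nu : nat) : Type :=
  'rV[R]_nx -> 'rV[R]_nu -> R.

Definition qnth (R : realType) (nx nu : nat) (qs : seq (qfun R nx nu))
    (i : 'I_(size qs)) : qfun R nx nu :=
  tnth (in_tuple qs) i.

(* Valued in \bar R only so that the maximum has a unit; it is finite as soon
   as qs is nonempty. *)
Definition qmax (R : realType) (nx nu : nat) (qs : seq (qfun R nx nu))
    (x : 'rV[R]_nx) (u : 'rV[R]_nu) : \bar R :=
  (\big[maxe/-oo]_(i < size qs) (qnth i x u)%:E)%E.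

(* Feasible triples (x', u', alpha) of the epigraph form of bellman (qmax qs)
   at the parameter (xh, uh). *)
Definition primal_feasible (R : realType) (nx nu nc : nat)
    (p : problem R nx nu nc) (qs : seq (qfun R nx nu))
    (xh : 'rV[R]_nx) (uh : 'rV[R]_nu) : set ('rV[R]_nx * 'rV[R]_nu * R) :=
  [set z | [/\ states p z.1.1 /\ actions p z.1.2,
               z.1.1 = dyn p xh uh,
               feasible p z.1.1 z.1.2
             & forall i : 'I_(size qs), qnth i z.1.1 z.1.2 <= z.2]].

Record dualvar (R : realType) (nx nc k : nat) := DualVar {
  mult_dyn : 'rV[R]_nx;
  mult_constr : 'rV[R]_nc;
  mult_epi : 'rV[R]_k
}.

Definition dual_feasible (R : realType) (nx nu nc : nat)
    (p : problem R nx nu nc) (k : nat) : set (dualvar R nx nc k) :=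
  [set y | [/\ \sum_(i < k) mult_epi y 0 i = discount p,
               forall i, 0 <= mult_constr y 0 i
             & forall i, 0 <= mult_epi y 0 i]].
Arguments dual_feasible {R nx nu nc} p {k} _.

Definition xi (R : realType) (nx nu nc : nat) (p : problem R nx nu nc)
    (qs : seq (qfun R nx nu)) (y : dualvar R nx nc (size qs)) : \bar R :=
  ereal_inf [set (- dotv (mult_dyn y) z.1
                  + dotv (mult_constr y) (constr p z.1 z.2)
                  + \sum_(i < size qs) mult_epi y 0 i * qnth i z.1 z.2)%:E
            | z in states p `*` actions p].

Definition dual_objective (R : realType) (nx nu nc : nat)
    (p : problem R nx nu nc) (qs : seq (qfun R nx nu))
    (xh : 'rV[R]_nx) (uh : 'rV[R]_nu) (y : dualvar R nx nc (size qs)) :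
    \bar R :=
  ((cost p xh uh + dotv (mult_dyn y) (dyn p xh uh))%:E + xi p y)%E.

Definition dual_value (R : realType) (nx nu nc : nat)
    (p : problem R nx nu nc) (qs : seq (qfun R nx nu))
    (xh : 'rV[R]_nx) (uh : 'rV[R]_nu) : \bar R :=
  ereal_sup [set dual_objective p xh uh y
            | y in (dual_feasible p : set (dualvar R nx nc (size qs)))].

Definition dual_optimal (R : realType) (nx nu nc : nat)
    (p : problem R nx nu nc) (qs : seq (qfun R nx nu))
    (xh : 'rV[R]_nx) (uh : 'rV[R]_nu) : set (dualvar R nx nc (size qs)) :=
  [set y | dual_feasible p y /\
           dual_objective p xh uh y = dual_value p qs xh uh].
Arguments dual_optimal {R nx nu nc} p qs xh uh _.

Definition strong_duality (R : realType) (nx nu nc : nat)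
    (p : problem R nx nu nc) (qs : seq (qfun R nx nu))
    (xh : 'rV[R]_nx) (uh : 'rV[R]_nu) : Prop :=
  dual_value p qs xh uh = bellman p (qmax qs) xh uh.

Definition is_dual_solver (R : realType) (nx nu nc : nat)
    (p : problem R nx nu nc)
    (sol : forall qs : seq (qfun R nx nu),
       'rV[R]_nx -> 'rV[R]_nu -> dualvar R nx nc (size qs)) : Prop :=
  forall qs xh uh, dual_optimal p qs xh uh !=set0 ->
    dual_optimal p qs xh uh (sol qs xh uh).

(* At a dual optimum with finite dual value xi is finite, so that fine only
   performs the coercion from \bar R to R. *)
Definition new_q (R : realType) (nx nu nc : nat) (p : problem R nx nu nc)
    (qs : seq (qfun R nx nu)) (y : dualvar R nx nc (size qs)) :
    qfun R nx nu :=
  fun x u => cost p x u + dotv (mult_dyn y) (dyn p x u) + fine (xi p y).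

Definition stopped (R : realType) (nx nu nc M : nat) (p : problem R nx nu nc)
    (pol : 'rV[R]_nx -> ('rV[R]_nx -> 'rV[R]_nu -> \bar R) -> 'rV[R]_nu)
    (xalg : 'I_M -> 'rV[R]_nx) (tol : R) (qs : seq (qfun R nx nu)) : bool :=
  (\big[maxe/-oo]_(m < M)
     bellman_error p (qmax qs) (xalg m) (pol (xalg m) (qmax qs)) <= tol%:E)%E.

(* One iteration with drawn index m. The list is left unchanged once the
   stopping test holds, so the iterations past termination add nothing. *)
Definition step (R : realType) (nx nu nc M : nat) (p : problem R nx nu nc)
    (pol : 'rV[R]_nx -> ('rV[R]_nx -> 'rV[R]_nu -> \bar R) -> 'rV[R]_nu)
    (sol : forall qs : seq (qfun R nx nu),
       'rV[R]_nx -> 'rV[R]_nu -> dualvar R nx nc (size qs))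
    (xalg : 'I_M -> 'rV[R]_nx) (tol : R) (qs : seq (qfun R nx nu))
    (m : 'I_M) : seq (qfun R nx nu) :=
  let xm := xalg m in
  let um := pol xm (qmax qs) in
  if stopped p pol xalg tol qs then qs
  else if `[< primal_feasible p qs xm um !=set0 /\
              dual_optimal p qs xm um !=set0 >]
  then rcons qs (new_q p (sol qs xm um))
  else qs.

(* The functions q_i available at iteration I when the successive drawn
   indices are w 0, w 1, ... *)
Fixpoint run (R : realType) (nx nu nc M : nat) (p : problem R nx nu nc)
    (pol : 'rV[R]_nx -> ('rV[R]_nx -> 'rV[R]_nu -> \bar R) -> 'rV[R]_nu)
    (sol : forall qs : seq (qfun R nx nu),
       'rV[R]_nx -> 'rV[R]_nu -> dualvar R nx nc (size qs))
    (xalg : 'I_M -> 'rV[R]_nx) (tol : R) (w : nat -> 'I_M) (I : nat) :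
    seq (qfun R nx nu) :=
  if I is J.+1 then step p pol sol xalg tol (run p pol sol xalg tol w J) (w J)
  else [:: cost p].

Definition terminates (R : realType) (nx nu nc M : nat)
    (p : problem R nx nu nc)
    (pol : 'rV[R]_nx -> ('rV[R]_nx -> 'rV[R]_nu -> \bar R) -> 'rV[R]_nu)
    (sol : forall qs : seq (qfun R nx nu),
       'rV[R]_nx -> 'rV[R]_nu -> dualvar R nx nc (size qs))
    (xalg : 'I_M -> 'rV[R]_nx) (tol : R) (w : nat -> 'I_M) : Prop :=
  exists I, stopped p pol xalg tol (run p pol sol xalg tol w I).

Definition uniform_draws (R : realType) (d : measure_display)
    (T : measurableType d) (P : probability T R) (M : nat)
    (draw : nat -> T -> 'I_M) : Prop :=
  forall I k, measurable (draw I @^-1` [set k]) /\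
              P (draw I @^-1` [set k]) = (M%:R^-1)%:E.

Definition independent_draws (R : realType) (d : measure_display)
    (T : measurableType d) (P : probability T R) (M : nat)
    (draw : nat -> T -> 'I_M) : Prop :=
  forall (J : seq nat) (A : nat -> set 'I_M), uniq J ->
    P (\bigcap_(I in [set` J]) (draw I @^-1` A I)) =
    (\prod_(I <- J) P (draw I @^-1` A I))%E.

(* Main.v *)
Require Import Defs.
From HB Require Import structures.
From mathcomp Require Import all_boot all_order all_algebra.
From mathcomp Require Import all_classical all_reals all_analysis.
From mathcomp Require Import lra.
Import Order.TTheory GRing.Theory Num.Theory.
Import numFieldNormedType.Exports.
Local Open Scope classical_set_scope.
Local Open Scope ring_scope.

Set Implicit Arguments.
Unset Strict Implicit.

(** Fix a path of draws and a state [x_m]. Whenever [m] is drawn at iteration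
    [n] while its Bellman error exceeds the tolerance, the cut that is added
    agrees at [(x_m, u_n)] with the Bellman image [v_n] of the current lower
    bound (strong duality, [new_q_tight]) and stays below [Qstar] everywhere
    ([weak_duality], [run_le_Qstar]). At a later iteration of the same kind the
    current lower bound, being Lipschitz in the action with a common constant
    and above the earlier cut, is already large near [u_n]; so each such draw
    raises [v] or moves [u] by a definite amount. Since the pairs [(u_n, v_n)]
    stay in a compact set, each [m] is drawn while violated only finitely often
    ([finitely_many_violated_draws]).

    Knowing only that every [m] is drawn infinitely often would leave a gap,
    since [m] might be drawn just at the iterations where its error is within
    the tolerance. As long as the algorithm
    runs, however, some [m] is violated, and one such target is determined by
    the past draws. The next draw is independent of the past and uniform, so it
    hits the target with probability [1 / M] whatever the past is; almost surely
    the target is hit infinitely often ([eventually_miss_negligible]). On a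
    non-terminating path this would give infinitely many violated draws, hence
    infinitely many for one index, which is impossible. *)

(** * Compactness and Lipschitz functions *)

Section Topology.
Context (R : realType) (V : normedModType R).

Lemma compact_close_terms (A : set V) (S : set nat) (z : nat -> V) (e : R) :
  compact A -> (forall N, exists2 n, (N <= n)%N & S n) ->
  (forall n, S n -> A (z n)) -> 0 < e ->
  exists k j, [/\ S k, S j, (k < j)%N & `|z k - z j| < e].
Proof.
move=> cA Sinf SA e0.
have /choice[f fP] : forall N, exists n, (N <= n)%N /\ S n.
  by move=> N; have [n Nn Sn] := Sinf N; exists n.
have [] := cA ((z \o f) n @[n --> \oo]) _.
  by exists 0%N => // n _; apply: SA; have [] := fP n.
move=> a [_ clus].
have e2 : 0 < e / 2 by rewrite divr_gt0.
have near_a N : exists2 n, (N <= n)%N & `|a - z (f n)| < e / 2.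
  have tailN : (z (f n) @[n --> \oo]) ((z \o f) @` [set n | (N <= n)%N]).
    by exists N => // n Nn; exists n.
  have [_ [[n Nn <-] an]] := clus _ _ tailN (nbhsx_ballx a _ e2).
  by exists n => //; rewrite -ball_normE in an.
have [k _ ak] := near_a 0%N.
have [j kj aj] := near_a (f k).+1.
exists (f k), (f j); split; try by have [] := fP k; have [] := fP j.
  by apply: leq_trans kj _; have [] := fP j.
rewrite (_ : _ - _ = (a - z (f j)) - (a - z (f k))); last first.
  by rewrite opprB [RHS]addrC subrKA.
by rewrite (le_lt_trans (ler_normB _ _)) // [e]splitr ltrD.
Qed.

Lemma lipschitz_within_continuous (A : set V) (L : R) (f : V -> R) :
  L.-lipschitz_A f -> {within A, continuous f}.
Proof.
move=> fL; apply/subspace_continuousP => x Ax.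
have L1 : 0 < `|L| + 1 by rewrite ltr_wpDl.
apply/cvgrPdist_lt => e e0; rewrite near_withinE.
have d0 : 0 < e / (`|L| + 1) by rewrite divr_gt0.
apply: filterS (nbhsx_ballx x _ d0) => y; rewrite -ball_normE /= => xy Ay.
apply: (@le_lt_trans _ _ (L * `|x - y|)); first exact: (fL (x, y)).
apply: (@le_lt_trans _ _ ((`|L| + 1) * `|x - y|)).
  by rewrite ler_wpM2r // (le_trans (ler_norm L)) // lerDl.
by rewrite mulrC -ltr_pdivlMr.
Qed.
End Topology.

Section SmallIncrease.
Context (R : realType) (V : normedModType R).

(** A compactness form of the pigeonhole principle: [K * [0, B]] being compact,
    two of the infinitely many points [(u n, v n)] are close to each other. *)
Lemma compact_small_increase (K : set V) (S : set nat) (u : nat -> V)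
    (v : nat -> R) (B L e : R) :
  compact K -> (forall N, exists2 n, (N <= n)%N & S n) ->
  (forall n, S n -> K (u n)) -> (forall n, S n -> v n \in `[0, B]) ->
  0 <= L -> 0 < e ->
  exists k j, [/\ S k, S j, (k < j)%N & v j - v k + L * `|u k - u j| < e].
Proof.
move=> cK Sinf Su Sv L0 e0.
have L1 : 0 < L + 1 by rewrite ltr_wpDl.
have [k [j [Sk Sj kj]]] := compact_close_terms
  (compact_setX cK (@segment_compact _ 0 B)) Sinf
  (z := fun n => (u n, v n)) (fun n Sn => conj (Su n Sn) (Sv n Sn))
  (divr_gt0 e0 L1).
have : L * (e / (L + 1)) + e / (L + 1) = e.
  by rewrite -{2}[e / _]mul1r -mulrDl mulrC divfK ?gt_eqF.
set r := e / _ => rE; rewrite prod_normE gt_max => /andP[/= uu vv].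
exists k, j; split=> //.
have Lu : L * `|u k - u j| <= L * r by rewrite ler_wpM2l // ltW.
have := ler_norm (v j - v k); rewrite distrC; lra.
Qed.
End SmallIncrease.

(** * Pointwise maxima of finite families *)

Section Problem.
Context (R : realType) (nx nu nc : nat) (p : problem R nx nu nc).
Implicit Types (qs : seq (qfun R nx nu)) (q : qfun R nx nu).
Implicit Types (x : 'rV[R]_nx) (u : 'rV[R]_nu).

(** Membership through an index, equality of functions not being decidable. *)
Definition lists qs q := exists i : 'I_(size qs), qnth i = q.

Lemma lists_rcons qs q q' : lists (rcons qs q) q' <-> lists qs q' \/ q' = q.
Proof.
split.
  move=> [[i ilt] <-]; rewrite /qnth (tnth_nth q) /= nth_rcons.
  move: (ilt); rewrite [X in (i < X)%N]size_rcons ltnS leq_eqVlt.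
  move=> /orP[/eqP ->|iqs].
    by right; rewrite ltnn eqxx.
  by left; rewrite iqs; exists (Ordinal iqs); rewrite /qnth (tnth_nth q).
move=> [[i <-]|->].
  have ilt : (i < size (rcons qs q))%N by rewrite size_rcons ltnW // ltnS.
  exists (Ordinal ilt); rewrite /qnth !(tnth_nth q) /= nth_rcons.
  by rewrite ltn_ord.
have ilt : (size qs < size (rcons qs q))%N by rewrite size_rcons.
by exists (Ordinal ilt); rewrite /qnth (tnth_nth q) /= nth_rcons ltnn eqxx.
Qed.

Lemma qmax_leP qs x u (z : \bar R) :
  (qmax qs x u <= z)%E <-> forall q, lists qs q -> ((q x u)%:E <= z)%E.
Proof.
split=> [/bigmax_leP[_ h] q [i <-]|h]; first exact: h.
by apply/bigmax_leP; split=> [|i _]; [exact: leNye|apply: h; exists i].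
Qed.

Lemma le_qmax qs q x u : lists qs q -> ((q x u)%:E <= qmax qs x u)%E.
Proof. by move: q; apply/qmax_leP. Qed.

Lemma qmax_fin_num qs q x u : lists qs q -> qmax qs x u \is a fin_num.
Proof.
move=> /(@le_qmax _ _ x u) qle; rewrite fin_numE; apply/andP; split.
  by apply: contraTneq qle => ->.
rewrite -ltey; apply: bigmax_lt => // i _; exact: ltry.
Qed.

Lemma fine_qmax qs q x u : lists qs q -> (fine (qmax qs x u))%:E = qmax qs x u.
Proof. by move=> /(@qmax_fin_num _ _ x u) /fineK. Qed.

Lemma qmax_lipschitz qs q x (K : set 'rV[R]_nu) (L : R) : lists qs q ->
  (forall q, lists qs q -> L.-lipschitz_K (q x)) ->
  L.-lipschitz_K (fine \o qmax qs x).
Proof.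
move=> qsq qL.
have half u u' : K u -> K u' ->
    fine (qmax qs x u) <= fine (qmax qs x u') + L * `|u - u'|.
  move=> Ku Ku'; rewrite -lee_fin (fine_qmax _ _ qsq).
  apply/qmax_leP => q' qsq'.
  have : (q' x u' <= fine (qmax qs x u')).
    by rewrite -lee_fin (fine_qmax _ _ qsq) le_qmax.
  have := le_trans (ler_norm _) (qL q' qsq' (u, u') (conj Ku Ku')).
  rewrite /= lee_fin lerBlDl => h1 h2.
  by rewrite (le_trans h1) // lerD2r.
move=> [u u'] [/= Ku Ku']; rewrite ler_norml lerBlDl half // andbT.
by rewrite lerNl opprB lerBlDl distrC half.
Qed.

(** A Lipschitz function attains its minimum on a compact set. This makes
    [is_policy] informative, as it says nothing where no minimizer exists. *)
Lemma argmins_nonempty qs q x (L : R) : lists qs q ->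
  compact (admissible p x) -> admissible p x !=set0 ->
  (forall q, lists qs q -> L.-lipschitz_(admissible p x) (q x)) ->
  argmins p (qmax qs) x !=set0.
Proof.
move=> qsq cK K0 qL.
have [u] := compact_EVT_min K0 cK
  (lipschitz_within_continuous (qmax_lipschitz qsq qL)).
rewrite inE => Ku uP; exists u; split=> // u' Ku'.
rewrite -(fine_qmax x u qsq) -(fine_qmax x u' qsq) lee_fin; apply: uP.
by rewrite inE.
Qed.

(** * Dynamic programming *)

Lemma traj_shift x (u : nat -> 'rV[R]_nu) t :
  traj p x u t.+1 = traj p (dyn p x (u 0%N)) (fun s => u s.+1) t.
Proof. by elim: t => //= t <-. Qed.

Lemma traj_states x (u : nat -> 'rV[R]_nu) t : states p x ->
  control_seqs p x u -> states p (traj p x u t).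
Proof.
move=> px pu; elim: t => //= t IHt; apply: dyn_states => //.
by have [] := pu t.
Qed.

Lemma total_cost_ge0 x (u : nat -> 'rV[R]_nu) :
  states p x -> control_seqs p x u -> (0 <= total_cost p x u)%E.
Proof.
move=> px pu; apply: nneseries_ge0 => t _ _; rewrite lee_fin mulr_ge0 //.
  by rewrite exprn_ge0 // ltW // discount_gt0.
by apply: cost_ge0; [exact: traj_states|have [] := pu t].
Qed.

Lemma Vstar_ge0 x : states p x -> (0 <= Vstar p x)%E.
Proof.
move=> px; apply: le_ereal_inf_tmp => _ [u pu <-]; exact: total_cost_ge0.
Qed.

Lemma total_cost_recl x (u : nat -> 'rV[R]_nu) :
  states p x -> control_seqs p x u ->
  total_cost p x u = ((cost p x (u 0%N))%:E +
    (discount p)%:E * total_cost p (dyn p x (u 0%N)) (fun t => u t.+1))%E.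
Proof.
move=> px pu; rewrite /total_cost.
have term_ge0 t : 0 <= discount p ^+ t * cost p (traj p x u t) (u t).
  rewrite mulr_ge0 ?exprn_ge0 ?(ltW (discount_gt0 _)) //.
  by apply: cost_ge0; [exact: traj_states|have [] := pu t].
rewrite nneseries_recl => [|t _|//]; last by rewrite lee_fin.
rewrite expr0 mul1r; congr (_ + _)%E.
rewrite -(nneseries_addn 1) => [|t]; last by rewrite lee_fin.
rewrite -nneseriesZl => [|t _]; last first.
  rewrite lee_fin -traj_shift mulr_ge0 ?exprn_ge0 ?(ltW (discount_gt0 _)) //.
  by apply: cost_ge0; [exact: traj_states|have [] := pu t.+1].
by apply: eq_eseriesr => t _; rewrite addn1 traj_shift -EFinM mulrA exprS.
Qed.

(** One step of dynamic programming: the cost of a control sequence is at least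
    the cost of its first action followed by optimal play. *)
Lemma Qstar_le_total_cost x (u : nat -> 'rV[R]_nu) :
  states p x -> control_seqs p x u ->
  (Qstar p x (u 0%N) <= total_cost p x u)%E.
Proof.
move=> px pu; rewrite total_cost_recl // leeD2l // lee_wpmul2l //.
  by rewrite lee_fin ltW // discount_gt0.
apply: ereal_inf_lbound; exists (fun t => u t.+1) => // t.
by rewrite -traj_shift; exact: pu.
Qed.

(** Bounding [Q] by [Qstar] along the first action of each control sequence
    bounds the infimum of [Q] over actions by the optimal value. *)
Lemma bellman_le_Qstar (Q : 'rV[R]_nx -> 'rV[R]_nu -> \bar R) x u :
  (forall x u, states p x -> actions p u -> (Q x u <= Qstar p x u)%E) ->
  states p x -> actions p u -> (bellman p Q x u <= Qstar p x u)%E.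
Proof.
move=> QQ px pu; rewrite leeD2l // lee_wpmul2l //.
  by rewrite lee_fin ltW // discount_gt0.
have px' := dyn_states px pu.
apply: le_ereal_inf_tmp => _ [v pv <-].
apply: le_trans (Qstar_le_total_cost px' pv).
have adm0 := pv 0%N; apply: le_trans (QQ _ _ px' (proj1 adm0)).
by apply: ereal_inf_lbound; exists (v 0%N).
Qed.

(** * Weak duality and tightness of the cuts *)

Lemma qmax_ge0 qs x u : lists qs (cost p) -> states p x -> actions p u ->
  (0 <= qmax qs x u)%E.
Proof.
move=> qsc px pu; apply: le_trans (le_qmax x u qsc).
by rewrite lee_fin cost_ge0.
Qed.

Lemma bellman_ge0 qs x u : lists qs (cost p) -> states p x -> actions p u ->
  (0 <= bellman p (qmax qs) x u)%E.
Proof.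
move=> qsc px pu; rewrite adde_ge0 ?lee_fin ?cost_ge0 // mule_ge0 //.
  by rewrite lee_fin ltW // discount_gt0.
apply: le_ereal_inf_tmp => _ [u' [pu' _] <-].
by apply: qmax_ge0 => //; exact: dyn_states.
Qed.

(** Dual feasibility and [xi] do not involve the parameter, so a dual solution
    found at one parameter bounds the Bellman image at all of them. For
    admissible [u'] at the successor, the constraint term is nonpositive and the
    epigraph term at most [discount * max_i q_i], since the epigraph multipliers
    are nonnegative with sum [discount]. *)
Lemma weak_duality qs q x u (y : dualvar R nx nc (size qs)) :
  lists qs q -> states p x -> actions p u -> dual_feasible p y ->
  (dual_objective p x u y <= bellman p (qmax qs) x u)%E.
Proof.
move=> qsq px pu [ysum yc ya].
have px' := dyn_states px pu; set x' := dyn p x u in px' *.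
rewrite /bellman -/x' -ereal_inf_pZl ?discount_gt0 // -leeBlDl //.
apply: le_ereal_inf_tmp => _ [_ [u' [pu' fu'] <-] <-].
rewrite leeBlDl // -(fine_qmax x' u' qsq) -EFinM -EFinD.
apply: (@le_trans _ _ ((cost p x u + dotv (mult_dyn y) x')%:E +
  (- dotv (mult_dyn y) x' + dotv (mult_constr y) (constr p x' u')
   + \sum_(i < size qs) mult_epi y 0 i * qnth i x' u')%:E)%E).
  by apply: leeD2l; apply: ereal_inf_lbound; exists (x', u').
have constr_le0 : dotv (mult_constr y) (constr p x' u') <= 0.
  by rewrite /dotv sumr_le0 // => i _; rewrite mulr_ge0_le0 // yc.
have epi_le : \sum_(i < size qs) mult_epi y 0 i * qnth i x' u' <=
    discount p * fine (qmax qs x' u').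
  rewrite -ysum mulr_suml ler_sum // => i _; rewrite ler_wpM2l //.
  by rewrite -lee_fin (fine_qmax _ _ qsq) le_qmax //; exists i.
by rewrite -EFinD lee_fin; lra.
Qed.

Section Cut.
Context (qs : seq (qfun R nx nu)) (x : 'rV[R]_nx) (u : 'rV[R]_nu).
Hypothesis (qsc : lists qs (cost p)) (px : states p x) (pu : actions p u).
Hypothesis dual : strong_duality p qs x u.

(** Strong duality with an attained dual optimum keeps the value off both
    infinities: [xi] is an infimum over a nonempty set of reals, so it is not
    [+oo], and the dual value is nonnegative like the stage cost. *)
Lemma xi_fin_num (y : dualvar R nx nc (size qs)) :
  dual_optimal p qs x u y -> xi p y \is a fin_num.
Proof.
move=> [_ yopt]; rewrite fin_numE; apply/andP; split.
  apply: contraTneq (bellman_ge0 qsc px pu) => xiy.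
  by rewrite -dual -yopt /dual_objective xiy addeNy.
rewrite -ltey; apply: le_lt_trans (ltry _).
by apply: ereal_inf_lbound; exists (x, u).
Qed.

Lemma new_qE (y : dualvar R nx nc (size qs)) x' u' : dual_optimal p qs x u y ->
  (new_q p y x' u')%:E = dual_objective p x' u' y.
Proof. by move=> /xi_fin_num xiy; rewrite /dual_objective EFinD fineK. Qed.

Lemma new_q_tight (y : dualvar R nx nc (size qs)) : dual_optimal p qs x u y ->
  (new_q p y x u)%:E = bellman p (qmax qs) x u.
Proof. by move=> yopt; rewrite new_qE // -dual; case: yopt. Qed.

Lemma new_q_le_bellman (y : dualvar R nx nc (size qs)) x' u' :
  dual_optimal p qs x u y -> states p x' -> actions p u' ->
  ((new_q p y x' u')%:E <= bellman p (qmax qs) x' u')%E.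
Proof.
move=> yopt px' pu'; rewrite new_qE //; apply: (weak_duality qsc) => //.
by case: yopt.
Qed.

(** An infeasible primal problem has value [+oo], which no dual variable
    attains. *)
Lemma primal_feasible_nonempty :
  dual_optimal p qs x u !=set0 -> primal_feasible p qs x u !=set0.
Proof.
move=> [y yopt].
have [[u' [pu' fu']]|none] := pselect (admissible p (dyn p x u) !=set0).
  exists (dyn p x u, u', fine (qmax qs (dyn p x u) u')); split => //=.
    by split=> //; exact: dyn_states.
  by move=> i; rewrite -lee_fin (fine_qmax _ _ qsc) le_qmax //; exists i.
have := new_q_tight yopt; rewrite /bellman.
have -> : admissible p (dyn p x u) = set0.
  by apply/seteqP; split=> // u' au'; apply: none; exists u'.
by rewrite image_set0 ereal_inf0 gt0_muley ?lte_fin ?discount_gt0.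
Qed.
End Cut.
End Problem.

(** * Paths of the algorithm *)

Section Run.
Context (R : realType) (nx nu nc : nat) (p : problem R nx nu nc).
Context (M : nat) (xalg : 'I_M -> 'rV[R]_nx).
Context (pol : 'rV[R]_nx -> ('rV[R]_nx -> 'rV[R]_nu -> \bar R) -> 'rV[R]_nu).
Context (sol : forall qs : seq (qfun R nx nu),
  'rV[R]_nx -> 'rV[R]_nu -> dualvar R nx nc (size qs)).
Context (tol : R) (tol_gt0 : 0 < tol).

Definition violates (qs : seq (qfun R nx nu)) (m : 'I_M) : bool :=
  ~~ (bellman_error p (qmax qs) (xalg m) (pol (xalg m) (qmax qs)) <= tol%:E)%E.

Lemma stoppedPn qs : ~~ stopped p pol xalg tol qs <-> exists m, violates qs m.
Proof.
split=> [/negP nst|[m viol]].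
  apply: contrapT => none; apply/nst/bigmax_leP; split=> [|m _].
    exact: leNye.
  by apply: contrapT => /negP viol; apply: none; exists m.
by apply: contra viol => /bigmax_leP[_]; apply.
Qed.

Lemma eq_run w w' n : (forall i, (i < n)%N -> w i = w' i) ->
  run p pol sol xalg tol w n = run p pol sol xalg tol w' n.
Proof.
elim: n => //= n IHn ww'; rewrite ww' // IHn // => i /ltnW; exact: ww'.
Qed.

Section Path.
Variable w : nat -> 'I_M.
Local Notation run := (run p pol sol xalg tol w).
Local Notation act n m := (pol (xalg m) (qmax (run n))).
Hypothesis xalg_states : forall m, states p (xalg m).
Hypothesis pol_policy : is_policy p pol.
Hypothesis sol_solver : is_dual_solver p sol.
Hypothesis Qstar_finite : forall m, exists2 u,
  admissible p (xalg m) u & (Qstar p (xalg m) u < +oo)%E.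
Hypothesis admissible_compact : forall m, compact (admissible p (xalg m)).
Hypothesis duality : forall n m,
  strong_duality p (run n) (xalg m) (act n m) /\
  dual_optimal p (run n) (xalg m) (act n m) !=set0.
Hypothesis q_lipschitz : forall m, exists L : R, forall n q,
  lists (run n) q -> L.-lipschitz_(admissible p (xalg m)) (q (xalg m)).

Definition cut n : qfun R nx nu :=
  new_q p (sol (run n) (xalg (w n)) (act n (w n))).

Lemma run_listsS n q : lists (run n) q -> lists (run n.+1) q.
Proof.
rewrite /= /step; case: ifP => // _; case: ifP => // _ nq.
by apply/lists_rcons; left.
Qed.

Lemma run_lists k n q : (k <= n)%N -> lists (run k) q -> lists (run n) q.
Proof.
move=> /subnK <-; elim: (n - k)%N => // i IHi /IHi; exact: run_listsS.
Qed.

Lemma run_cost n : lists (run n) (cost p).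
Proof. by apply: (run_lists (leq0n n)); exists ord0. Qed.

Lemma act_admissible n m : admissible p (xalg m) (act n m).
Proof.
have [L qL] := q_lipschitz m; have [u Ku _] := Qstar_finite m.
have K0 : admissible p (xalg m) !=set0 by exists u.
have argmin_ne :=
  argmins_nonempty (run_cost n) (@admissible_compact m) K0 (qL n).
by case: (pol_policy argmin_ne).
Qed.

Lemma act_actions n m : actions p (act n m).
Proof. by case: (act_admissible n m). Qed.

Lemma sol_optimal n m : dual_optimal p (run n) (xalg m) (act n m)
  (sol (run n) (xalg m) (act n m)).
Proof. by apply: sol_solver; have [] := duality n m. Qed.

Lemma cut_tight n : ((cut n (xalg (w n)) (act n (w n)))%:E =
  bellman p (qmax (run n)) (xalg (w n)) (act n (w n)))%E.
Proof.
have [sd _] := duality n (w n).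
exact: (new_q_tight (run_cost n) _ (act_actions n _) sd (sol_optimal n _)).
Qed.

(** A cut lies below the Bellman image of the current maximum, and the Bellman
    operator preserves lower bounds of [Qstar]. This is what bounds the values
    of the cuts from above. *)
Lemma run_le_Qstar n x u : states p x -> actions p u ->
  (qmax (run n) x u <= Qstar p x u)%E.
Proof.
elim: n x u => [|n IHn] x u px pu.
  apply/qmax_leP => q [i <-]; rewrite [qnth _](_ : _ = cost p); last first.
    by rewrite /qnth (tnth_nth (cost p)); case: i => -[].
  rewrite /Qstar leeDl // mule_ge0 ?Vstar_ge0 //; last exact: dyn_states.
  by rewrite lee_fin ltW // discount_gt0.
rewrite /= /step; case: ifP => _; first exact: IHn.
case: ifP => _; last exact: IHn.
apply/qmax_leP => q /lists_rcons[nq|->].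
  exact: le_trans (le_qmax x u nq) (IHn _ _ px pu).
have [sd _] := duality n (w n).
apply: le_trans (bellman_le_Qstar IHn px pu).
exact: (new_q_le_bellman (run_cost n) _ (act_actions n _) sd (sol_optimal n _)).
Qed.

(** Duality makes the primal problem feasible, so every failed stopping test is
    followed by the addition of a cut. *)
Lemma run_cut n : ~~ stopped p pol xalg tol (run n) ->
  lists (run n.+1) (cut n).
Proof.
move=> /negbTE nst; rewrite /= /step nst; case: ifPn => [_|/asboolP[]].
  by apply/lists_rcons; right.
have [sd yopt] := duality n (w n); split=> //.
exact: (primal_feasible_nonempty (run_cost n) _ (act_actions n _) sd).
Qed.

(** Suppose [m] is drawn infinitely often while violated, at actions [u n]
    where the cut added has value [v n]. A cut added at [k] is present at a
    later such [j], so violation at [j] forces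
    [tol < v j - v k + L * |u k - u j|]. The pairs [(u n, v n)] range over a
    compact set, because the values [v n] are nonnegative and, by the Lipschitz
    bound, not much larger than the finite optimal value at one fixed
    action. So two of these pairs are close, a contradiction. *)
Lemma finitely_many_violated_draws m :
  exists N, forall n, (N <= n)%N -> ~ (w n = m /\ violates (run n) m).
Proof.
apply: contrapT => noN.
pose S := [set n | w n = m /\ violates (run n) m].
have Sinf N : exists2 n, (N <= n)%N & S n.
  apply: contrapT => none; apply: noN; exists N => n Nn Sn.
  by apply: none; exists n.
pose K := admissible p (xalg m); pose x := xalg m.
pose u n := act n m; pose v n := cut n x (u n).
have Ku n : K (u n) by exact: act_admissible.
have cut_listed k j : S k -> (k < j)%N -> lists (run j) (cut k).
  move=> [_ viol] kj; apply: (run_lists kj); apply: run_cut.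
  by apply/stoppedPn; exists m.
have vE n : S n -> (v n)%:E = bellman p (qmax (run n)) x (u n).
  by move=> [wn _]; rewrite /v /u /x -wn; exact: cut_tight.
have [L0 qL0] := q_lipschitz m.
have lip n q a b : lists (run n) q -> K a -> K b ->
    q x a - q x b <= `|L0| * `|a - b|.
  move=> nq Ka Kb; apply: le_trans (ler_norm _) _.
  apply: le_trans (qL0 n q nq (a, b) (conj Ka Kb)) _.
  by rewrite ler_wpM2r // ler_norm.
have gap n q : S n -> lists (run n) q -> q x (u n) + tol < v n.
  move=> Sn nq; have [_] := Sn; rewrite /violates -ltNge /bellman_error.
  rewrite -/x -/(u n) -(vE n Sn) -(fine_qmax x (u n) nq) -EFinB lte_fin.
  have : q x (u n) <= fine (qmax (run n) x (u n)).
    by rewrite -lee_fin (fine_qmax _ _ nq) le_qmax.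
  lra.
have separated k j : S k -> S j -> (k < j)%N ->
    tol < (v j - v k) + `|L0| * `|u k - u j|.
  move=> Sk Sj kj; have kj' := cut_listed k j Sk kj.
  have := gap j _ Sj kj'; have := lip j _ (u k) (u j) kj' (Ku k) (Ku j).
  rewrite -/(v k); lra.
have [uh Kuh Quh] := Qstar_finite m.
have [D D_gt0 KD] : exists2 D : R, 0 < D & forall a, K a -> `|a| <= D.
  have [D D0 KD] := pinfty_ex_gt0 (compact_bounded (@admissible_compact m)).
  by exists D.
have px : states p x by exact: xalg_states.
have Quh_ge0 : (0 <= Qstar p x uh)%E.
  have puh : actions p uh by case: Kuh.
  exact: le_trans (qmax_ge0 (run_cost 0) px puh) (run_le_Qstar 0 px puh).
pose B := fine (Qstar p x uh) + `|L0| * (D + D).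
have v_bounds n : S n -> v n \in `[0, B].
  move=> Sn; rewrite in_itv /= -lee_fin vE // bellman_ge0 //=; last first.
  - exact: act_actions.
  - exact: run_cost.
  have cn := cut_listed n n.+1 Sn (ltnSn n).
  have cuh : cut n x uh <= fine (Qstar p x uh).
    rewrite -lee_fin fineK ?ge0_fin_numE //.
    apply: le_trans (le_qmax _ _ cn) (run_le_Qstar _ px _).
    by case: Kuh.
  have un : `|u n - uh| <= D + D.
    by apply: le_trans (ler_normB _ _) _; rewrite lerD // KD.
  have := lip _ _ (u n) uh cn (Ku n) Kuh; rewrite -/(v n) /B.
  have : `|L0| * `|u n - uh| <= `|L0| * (D + D) by rewrite ler_wpM2l.
  lra.
have [k [j [Sk Sj kj]]] := compact_small_increase (@admissible_compact m) Sinf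
  (fun n _ => Ku n) v_bounds (normr_ge0 L0) tol_gt0.
by rewrite ltNge ltW // separated.
Qed.
End Path.
End Run.

(** * Hitting a moving target with independent uniform draws *)

Section Draws.
Context (R : realType) (d : measure_display) (T : measurableType d).
Context (P : probability T R) (M : nat) (draw : nat -> T -> 'I_M).
Hypothesis draw_uniform : uniform_draws P draw.
Hypothesis draw_independent : independent_draws P draw.

(** With [X := Prop] this covers events too, as [set T] is [T -> Prop]. *)
Definition predictable (n : nat) (X : Type) (g : T -> X) : Prop :=
  forall w w', (forall i, (i < n)%N -> draw i w = draw i w') -> g w = g w'.

Lemma draws_gt0 : (0 < M)%N.
Proof.
have [/set0P[w _]|/negPn/eqP T0] := boolP ([set: T] != set0).
  exact: leq_ltn_trans (ltn_ord (draw 0 w)).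
by have := oner_neq0 R; rewrite -eqe -(probability_setT P) T0 measure0 eqxx.
Qed.

Lemma predictableS n (X : Type) (g : T -> X) :
  predictable n g -> predictable n.+1 g.
Proof. by move=> gn w w' ww'; apply: gn => i /leqW; apply: ww'. Qed.

(** The information available before draw [n], as a value in a finite type. *)
Definition history n w : {ffun 'I_n -> 'I_M} := [ffun i : 'I_n => draw i w].

Lemma predictable_history n (X : Type) (g : T -> X) w w' :
  predictable n g -> history n w = history n w' -> g w = g w'.
Proof.
move=> gn /ffunP ww'; apply: gn => i ltin.
by have := ww' (Ordinal ltin); rewrite !ffunE.
Qed.

Lemma measurable_draw i (A : set 'I_M) : measurable (draw i @^-1` A).
Proof.
have -> : draw i @^-1` A = \bigcup_(k in A) draw i @^-1` [set k].
  apply/seteqP; split=> [w Aw|w [k Ak wk]]; first by exists (draw i w).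
  by rewrite /preimage /= wk.
by apply: fin_bigcup_measurable => // k _; have [] := draw_uniform i k.
Qed.

(** The values of draw [i] compatible with [s]: one value if [i < n], all of
    them otherwise. They present the event that the history is [s] as an
    intersection of events about single draws, the form to which mutual
    independence applies. *)
Definition slot n (s : {ffun 'I_n -> 'I_M}) (i : nat) : set 'I_M :=
  [set k | forall j : 'I_n, j = i :> nat -> k = s j].

Lemma history_preimage n s :
  history n @^-1` [set s] =
  \bigcap_(i in [set` iota 0 n]) (draw i @^-1` slot s i).
Proof.
apply/seteqP; split=> w /=.
  by move=> <- i _ j <-; rewrite ffunE.
move=> hw; apply/ffunP => i; rewrite ffunE.
by apply: hw => //=; rewrite mem_iota /=.
Qed.

Lemma measurable_history n s : measurable (history n @^-1` [set s]).
Proof.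
rewrite history_preimage; apply: bigcap_measurableType => i _.
exact: measurable_draw.
Qed.

(** [n] draws have finitely many histories, so a predictable event is a finite
    union of measurable history classes. *)
Lemma measurable_predictable n (A : set T) : predictable n A -> measurable A.
Proof.
move=> An.
have -> : A = \bigcup_(s in history n @` A) history n @^-1` [set s].
  apply/seteqP; split=> [w Aw|w [_ [w' Aw' <-]] /= ww'].
    by exists (history n w).
  by rewrite (predictable_history An ww').
by apply: fin_bigcup_measurable => // s _; exact: measurable_history.
Qed.

Lemma history_draw_indep n s k :
  P (history n @^-1` [set s] `&` draw n @^-1` [set k]) =
  (P (history n @^-1` [set s]) * (M%:R^-1)%:E)%E.
Proof.
pose A i := if i == n then [set k] else slot s i.
have AE i : i \in iota 0 n -> A i = slot s i.
  by rewrite mem_iota /A => /andP[_]; case: eqP => // ->; rewrite ltnn.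
have iota_rcons : iota 0 n.+1 = iota 0 n ++ [:: n] by rewrite -addn1 iotaD.
have -> : history n @^-1` [set s] `&` draw n @^-1` [set k] =
    \bigcap_(i in [set` iota 0 n.+1]) (draw i @^-1` A i).
  rewrite history_preimage iota_rcons; apply/seteqP; split=> w.
    move=> [hs hk] i; rewrite /= mem_cat => /orP[|].
      by move=> iin; rewrite AE //; apply: hs.
    by rewrite inE => /eqP ->; rewrite /A eqxx.
  move=> h; split.
    move=> i /= iin; have := h i; rewrite /= AE //; apply.
    by rewrite mem_cat iin.
  by have := h n; rewrite /A eqxx; apply; rewrite /= mem_cat inE eqxx orbT.
rewrite draw_independent ?iota_uniq //.
rewrite history_preimage draw_independent ?iota_uniq //.
rewrite iota_rcons big_cat big_seq1 {2}/A eqxx.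
have [_ ->] := draw_uniform n k; congr (_ * _)%E.
by apply: eq_big_seq => i /AE ->.
Qed.

Lemma measure_history_sum n (A : set T) : measurable A ->
  P A = (\sum_(s \in [set: {ffun 'I_n -> 'I_M}])
           P (A `&` history n @^-1` [set s]))%E.
Proof.
move=> mA; rewrite -measure_fin_bigcup //.
- rewrite -setI_bigcupr; congr (P _).
  apply/seteqP; split=> [w Aw|w []//].
  by split=> //; exists (history n w).
- exact: finite_finset.
- by move=> s s' _ _ [w [[_ /= <-] [_ /= <-]]].
- by move=> s _; apply: measurableI => //; exact: measurable_history.
Qed.

(** On each history class a predictable target is constant, hence hit with
    probability [1 / M]; summing over the classes gives the general case. *)
Lemma predictable_draw_indep n (A : set T) (g : T -> 'I_M) :
  predictable n A -> predictable n g ->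
  P (A `&` [set w | draw n w = g w]) = (P A * (M%:R^-1)%:E)%E.
Proof.
move=> An gn.
have mA := measurable_predictable An.
have mD : measurable (A `&` [set w | draw n w = g w]).
  apply: (@measurable_predictable n.+1) => w w' ww' /=.
  rewrite /setI /mkset /= (predictableS An ww') (predictableS gn ww').
  by rewrite (ww' n).
rewrite (measure_history_sum n mD) (measure_history_sum n mA).
rewrite ge0_mule_fsuml //; apply: eq_fsbigr => s _.
have [[w [Aw ws]]|As] := pselect (A `&` history n @^-1` [set s] !=set0).
  have AE : A `&` history n @^-1` [set s] = history n @^-1` [set s].
    apply/setIidr => w' /= w's; rewrite (predictable_history An (w' := w)) //.
    by rewrite w's ws.
  rewrite AE -(history_draw_indep s (g w)); congr (P _).
  apply/seteqP; split=> w' /=.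
    move=> [[_ ->] w's]; split=> //.
    by apply: (predictable_history gn); rewrite w's ws.
  move=> [w's ->]; split=> //; split.
    by rewrite (predictable_history An (w' := w)) // w's ws.
  by apply: (predictable_history gn); rewrite w's ws.
have -> : A `&` history n @^-1` [set s] = set0.
  by apply/seteqP; split=> // w' Aw'; apply: As; exists w'.
rewrite (_ : _ `&` _ = set0) ?measure0 ?mul0e //.
by apply/seteqP; split=> // w' [[Aw' _] w's]; apply: As; exists w'.
Qed.

Definition misses (g : nat -> T -> 'I_M) (D : set nat) : set T :=
  [set w | forall i, D i -> draw i w <> g i w].

Lemma predictable_misses (g : nat -> T -> 'I_M) n (D : set nat) :
  (forall i, predictable i (g i)) -> D `<=` [set i | (i < n)%N] ->
  predictable n (misses g D).
Proof.
move=> gi Dn; suff half w w' : (forall i, (i < n)%N -> draw i w = draw i w') ->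
    misses g D w -> misses g D w'.
  move=> w w' ww'; apply/propext; split; apply: half => // i /ww' //.
move=> ww' h i Di; have lin := Dn _ Di.
rewrite -ww' // -(gi i w w'); first exact: h.
by move=> j ji; apply/ww'/(ltn_trans ji).
Qed.

(** Independence multiplies the probability of a miss by [1 - 1 / M] at each
    draw, although the target moves with the past. *)
Lemma miss_probability (g : nat -> T -> 'I_M) N k :
  (forall n, predictable n (g n)) ->
  P (misses g [set i | (N <= i < N + k)%N]) = ((1 - M%:R^-1) ^+ k)%:E.
Proof.
move=> gn.
pose miss k := misses g [set i | (N <= i < N + k)%N].
have missP j : predictable (N + j) (miss j).
  by apply: predictable_misses => // i /= /andP[].
have mm j := measurable_predictable (missP j).
rewrite -/(miss k).
elim: k => [|k IHk].
  rewrite expr0 -(probability_setT P); congr (P _).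
  by apply/seteqP; split=> // w _ i /andP[]; rewrite addn0 leqNgt => /negP.
pose hit := [set w | draw (N + k)%N w = g (N + k)%N w].
have mhit : measurable hit.
  apply: (@measurable_predictable (N + k).+1) => w w' ww' /=.
  by rewrite /hit /mkset (predictableS (gn _) ww') (ww' (N + k)%N).
have -> : miss k.+1 = miss k `\` hit.
  apply/seteqP; split=> w.
    move=> h; split=> [i /andP[Ni ik]|]; last first.
      by apply: h; rewrite /= leq_addr addnS ltnSn.
    by apply: h; rewrite /= Ni addnS ltnS ltnW.
  move=> [h hk] i /=; rewrite addnS ltnS (leq_eqVlt i).
  by move=> /andP[Ni /orP[/eqP->//|ik]]; apply: h; rewrite /= Ni.
have -> : P (miss k `\` hit) = (P (miss k) - P (miss k `&` hit))%E.
  apply: measureD => //.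
  exact: le_lt_trans (probability_le1 P (mm k)) (ltry _).
rewrite (predictable_draw_indep (missP k) (gn _)) IHk -EFinM -EFinB.
by rewrite exprSr mulrBr mulr1.
Qed.

(** The substitute for the second Borel-Cantelli lemma: missing [k] times in a
    row has probability [(1 - 1 / M) ^ k], which tends to [0]. *)
Lemma eventually_miss_negligible (g : nat -> T -> 'I_M) :
  (forall n, predictable n (g n)) ->
  P.-negligible [set w | exists N, forall i, (N <= i)%N -> draw i w <> g i w].
Proof.
move=> gn.
apply: (@negligibleS _ _ _ _ (\bigcup_N misses g [set i | (N <= i)%N])).
  by move=> w [N h]; exists N.
apply: negligible_bigcup => N; set F := misses g _.
have mF : measurable F.
  have -> : F = \bigcap_n misses g [set i | (N <= i < N + n)%N].
    apply/seteqP; split=> [w h n _ i /= /andP[Ni _]|w h i /= Ni].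
      exact: h.
    by apply: (h i.+1) => //=; rewrite Ni addnS ltnS leq_addl.
  apply: bigcapT_measurable => n; apply: (@measurable_predictable (N + n)).
  by apply: predictable_misses => // i /= /andP[].
suff PF0 : P F = 0%E by exact/negligibleP.
apply/eqP; rewrite eq_le measure_ge0 andbT.
have bnd k : (P F <= ((1 - M%:R^-1) ^+ k)%:E)%E.
  rewrite -(miss_probability N k gn); apply: le_measure; rewrite ?inE //.
    apply: (@measurable_predictable (N + k)).
    by apply: predictable_misses => // i /= /andP[].
  by move=> w h i /= /andP[Ni _]; apply: h.
have M0 := draws_gt0.
have lt1 : `|1 - M%:R^-1 : R| < 1.
  have M1 : 0 < (M%:R : R)^-1 by rewrite invr_gt0 ltr0n.
  have M2 : (M%:R : R)^-1 <= 1 by rewrite invf_le1 ?ltr0n // ler1n.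
  by rewrite ger0_norm ?subr_ge0 // gtrBl.
have : (0 <= P F)%E by exact: measure_ge0.
move: bnd; case: (P F) => [r bnd _|/(_ 0)|//]; last by rewrite leye_eq.
rewrite lee_fin; apply: (@cvgr_to_ge _ _ _ _ _ _ _ (cvg_geometric 1 lt1)).
by apply: nearW => k; rewrite /geometric /= mul1r -lee_fin.
Qed.
End Draws.

(** * Almost sure termination *)

Unset Implicit Arguments.
Set Strict Implicit.

Theorem mainTheorem1 (R : realType) (nx nu nc : nat) (p : problem R nx nu nc)
  (M : nat) (xalg : 'I_M -> 'rV[R]_nx)
  (pol : 'rV[R]_nx -> ('rV[R]_nx -> 'rV[R]_nu -> \bar R) -> 'rV[R]_nu)
  (sol : forall qs : seq (qfun R nx nu),
     'rV[R]_nx -> 'rV[R]_nu -> dualvar R nx nc (size qs))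
  (tol : R)
  (d : measure_display) (T : measurableType d) (P : probability T R)
  (draw : nat -> T -> 'I_M)
  (xalg_states : forall m, states p (xalg m))
  (pol_policy : is_policy p pol)
  (sol_solver : is_dual_solver p sol)
  (draw_uniform : uniform_draws P draw)
  (draw_independent : independent_draws P draw)
  (Qstar_finite : forall m, exists2 u,
     admissible p (xalg m) u & (Qstar p (xalg m) u < +oo)%E)
  (admissible_compact : forall m, compact (admissible p (xalg m)))
  (dyn_lipschitz : forall m (j : 'I_nx),
     [lipschitz dyn p (xalg m) u 0 j | u in admissible p (xalg m)])
  (duality : forall (w : T) (I : nat) (m : 'I_M),
     let qs := run p pol sol xalg tol (fun i => draw i w) I in
     let um := pol (xalg m) (qmax qs) in
     strong_duality p qs (xalg m) um /\
     dual_optimal p qs (xalg m) um !=set0)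
  (q_lipschitz : forall (w : T) (m : 'I_M), exists L : R, forall I : nat,
     let qs := run p pol sol xalg tol (fun i => draw i w) I in
     forall i : 'I_(size qs),
       L.-lipschitz_(admissible p (xalg m)) (qnth i (xalg m)))
  (tol_gt0 : 0 < tol) :
  let termination :=
    [set w | terminates p pol sol xalg tol (fun i => draw i w)] in
  measurable termination /\ P termination = 1%E.
Proof.
set trajectory := fun w n => run p pol sol xalg tol (fun i => draw i w) n.
move=> termination.
(* The default is never used on a non-terminating path; it is a constant so
   that the target at iteration 0 depends on no draw. *)
pose target n w := odflt (Ordinal (draws_gt0 P draw))
  [pick m | violates p xalg pol tol (trajectory w n) m].
have traj_pred n : predictable draw n (trajectory^~ n).
  by move=> w w' ww'; exact: eq_run.
have target_pred n : predictable draw n (target n).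
  by move=> w w' /traj_pred; rewrite /target => ->.
have mterm : measurable termination.
  have -> : termination =
      \bigcup_n [set w | stopped p pol xalg tol (trajectory w n)].
    by apply/seteqP; split=> w [n] => [|_] st; exists n.
  apply: bigcupT_measurable => n.
  apply: (measurable_predictable draw_uniform (n := n)).
  by move=> w w' /traj_pred; rewrite /mkset => ->.
split=> //.
suff null : P.-negligible (~` termination).
  rewrite -[termination]setCK probability_setC; last exact: measurableC.
  have -> : P (~` termination) = 0%E.
    by apply/negligibleP => //; exact: measurableC.
  by rewrite sube0.
apply: negligibleS
  (eventually_miss_negligible draw_uniform draw_independent target_pred).
move=> w nterm.
have nstop n : ~~ stopped p pol xalg tol (trajectory w n).
  by apply/negP => st; apply: nterm; exists n.
have lip m : exists L : R, forall n q, lists (trajectory w n) q ->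
    L.-lipschitz_(admissible p (xalg m)) (q (xalg m)).
  by have [L qL] := q_lipschitz w m; exists L => n q [i <-]; exact: qL.
have /choice[N NP] := finitely_many_violated_draws tol_gt0 xalg_states
  pol_policy sol_solver Qstar_finite admissible_compact (duality w) lip.
exists (\max_m N m)%N => n maxn hit.
apply: (NP (target n w) n); first exact: leq_trans (leq_bigmax _) maxn.
split=> //; rewrite /target; case: pickP => //= none.
by have /stoppedPn[m] := nstop n; rewrite none.
Qed.
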